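(* Let $k\ge 2$ and let $\{M_j\}$ be a collection of elements of $\mathrm{PGL}_k(\mathbb{C})$, each with $\mathrm{PGL}_k(\mathbb{R})$-compatible generic eigenvalues. Then the collection is simultaneously conjugate into $\mathrm{PGL}_k(\mathbb{R})$ if and only if there exists an $\mathbb{R}$-form $R$ in $\mathbb{C}^k$ such that, for every $M_j$, the eigendirections of $M_j$ respect the conjugation of $\mathbb{C}^k$ corresponding to $R$.
   Context: $\mathrm{PGL}_k(\mathbb{R})$ is regarded as the image of $\mathrm{GL}_k(\mathbb{R})$ in $\mathrm{PGL}_k(\mathbb{C})$. A collection $\{M_j\}\subset \mathrm{PGL}_k(\mathbb{C})$ is simultaneously conjugate into $\mathrm{PGL}_k(\mathbb{R})$ if there is a single $\Gamma\in \mathrm{PGL}_k(\mathbb{C})$ with $\Gamma^{-1}M_j\Gamma\in \mathrm{PGL}_k(\mathbb{R})$ for all $j$. Eigenvalues of $M\in\mathrm{PGL}_k(\mathbb{C})$ are those of a matrix representative (so defined up to a common nonzero complex scalar); eigendirections are the corresponding points of $\mathbb{C}P^{k-1}$. The eigenvalues of $M$ are $\mathrm{PGL}_k(\mathbb{R})$-compatible if there is a real line $\ell$ through $0$ in $\mathbb{C}$ such that every eigenvalue either lies in $\ell$ or is swapped with another eigenvalue by reflection about $\ell$. Eigenvalues in $\ell$ and their eigendirections are called hyperbolic; eigenvalues swapped in pairs by the reflection, and their eigendirections, are called elliptic, and the two eigendirections of such a pair form an elliptic eigendirection pair. $M$ has generic eigenvalues if a representative has no repeated eigenvalues and no two eigenvalues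 are both contained in some line through $0$ and swapped by reflection about some line through $0$; the transformations considered are such that the choice of $\ell$ does not affect which eigendirections are labelled hyperbolic or elliptic, nor the pairing. An $\mathbb{R}$-form in $\mathbb{C}^k$ is the real span of a $\mathbb{C}$-basis of $\mathbb{C}^k$. A conjugation on $\mathbb{C}^k$ is a conjugate-linear involution; the conjugation corresponding to an $\mathbb{R}$-form $R$ is componentwise complex conjugation of coordinates in a basis whose real span is $R$. It induces a map on $\mathbb{C}P^{k-1}$. A collection of eigendirections respects a conjugation if the hyperbolic eigendirections are fixed by it and the two members of each elliptic eigendirection pair are swapped by it (as points of $\mathbb{C}P^{k-1}$). *)

(* Defs.v *)
From HB Require Import structures.
From mathcomp Require Import all_boot all_order all_algebra.
From mathcomp Require Import boolp classical_sets reals.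
From mathcomp Require Import complex.

Set Implicit Arguments.
Unset Strict Implicit.
Unset Printing Implicit Defensive.

Import Order.TTheory GRing.Theory Num.Theory.
Local Open Scope classical_set_scope.
Local Open Scope ring_scope.
Local Open Scope complex_scope.
Local Open Scope quotient_scope.

(* The complex field is R[i], for R : realType.  Matrices act on column
   vectors by left multiplication. *)

Section GL.
Variables (F : fieldType) (k : nat).

(* MathComp's {'GL_n[F]} requires F to be finite. *)
Record GL := MkGL { GLmx :> 'M[F]_k; GLmx_unit : GLmx \in unitmx }.

HB.instance Definition _ := [isSub for GLmx].
HB.instance Definition _ := [Choice of GL by <:].

Definition GL_mul (A B : GL) : GL :=
  @MkGL (A *m B)
    (etrans (unitmx_mul A B) (introT andP (conj (GLmx_unit A) (GLmx_unit B)))).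
Definition GL_one : GL := @MkGL 1%:M (unitmx1 F k).
Definition GL_inv (A : GL) : GL :=
  @MkGL (invmx A) (etrans (unitmx_inv A) (GLmx_unit A)).

Fact GL_mulA : associative GL_mul.
Proof. by move=> A B D; apply/val_inj/mulmxA. Qed.
Fact GL_mul1 : left_id GL_one GL_mul.
Proof. by move=> A; apply/val_inj/mul1mx. Qed.
Fact GL_mulr1 : right_id GL_one GL_mul.
Proof. by move=> A; apply/val_inj/mulmx1. Qed.
Fact GL_mulV : left_inverse GL_one GL_inv GL_mul.
Proof. by move=> A; apply/val_inj/mulVmx/GLmx_unit. Qed.
Fact GL_mulrV : right_inverse GL_one GL_inv GL_mul.
Proof. by move=> A; apply/val_inj/mulmxV/GLmx_unit. Qed.
HB.instance Definition _ :=
  isGroup.Build GL GL_mulA GL_mul1 GL_mulr1 GL_mulV GL_mulrV.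

Definition proj_eq : rel GL :=
  fun A B => `[< exists2 c : F, c != 0 & GLmx A = c *: GLmx B >].

Fact proj_eq_refl : reflexive proj_eq.
Proof. by move=> A; apply/asboolP; exists 1; rewrite ?oner_eq0 // scale1r. Qed.

Fact proj_eq_sym : symmetric proj_eq.
Proof.
suff H A B : proj_eq A B -> proj_eq B A by move=> A B; apply/idP/idP; apply: H.
move=> /asboolP[c c0 e]; apply/asboolP; exists c^-1; first by rewrite invr_eq0.
by rewrite e scalerA mulVf // scale1r.
Qed.

Fact proj_eq_trans : transitive proj_eq.
Proof.
move=> B A D /asboolP[c c0 e] /asboolP[d d0 e']; apply/asboolP.
by exists (c * d); rewrite ?mulf_neq0 // e e' scalerA.
Qed.

Canonical proj_eq_equiv :=
  EquivRel proj_eq proj_eq_refl proj_eq_sym proj_eq_trans.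

Definition PGL := {eq_quot proj_eq}.
HB.instance Definition _ := Choice.on PGL.
HB.instance Definition _ := EqQuotient.on PGL.

Definition toPGL (A : GL) : PGL := \pi_PGL A.

Lemma toPGLP (A B : GL) :
  toPGL A = toPGL B <-> exists2 c : F, c != 0 & GLmx A = c *: GLmx B.
Proof.
by split=> [/eqP|?]; [|apply/eqP]; rewrite /toPGL eqmodE; move/asboolP || apply/asboolP.
Qed.

Definition PGL_mul (x y : PGL) : PGL := toPGL (repr x * repr y)%g.
Definition PGL_one : PGL := toPGL 1%g.
Definition PGL_inv (x : PGL) : PGL := toPGL (repr x)^-1%g.

Lemma repr_toPGL (A : GL) :
  exists2 c : F, c != 0 & repr (toPGL A) = c *: GLmx A :> 'M[F]_k.
Proof. by apply/toPGLP; rewrite /toPGL reprK. Qed.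

Lemma toPGL_mul (A B : GL) : toPGL (A * B)%g = PGL_mul (toPGL A) (toPGL B).
Proof.
apply/esym/toPGLP; have [c c0 e] := repr_toPGL A; have [d d0 e'] := repr_toPGL B.
exists (c * d); first by rewrite mulf_neq0.
by rewrite /= e e' -scalemxAl -scalemxAr scalerA.
Qed.

Lemma toPGL_inv (A : GL) : toPGL A^-1%g = PGL_inv (toPGL A).
Proof.
apply/esym/toPGLP; have [c c0 e] := repr_toPGL A.
exists c^-1; first by rewrite invr_eq0.
by rewrite /= e invmxZ // -e GLmx_unit.
Qed.

Lemma toPGL_repr (x : PGL) : toPGL (repr x) = x.
Proof. exact: reprK. Qed.

Fact PGL_mulA : associative PGL_mul.
Proof.
move=> x y z; rewrite -(toPGL_repr x) -(toPGL_repr y) -(toPGL_repr z).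
by rewrite -!toPGL_mul mulgA.
Qed.
Fact PGL_mul1 : left_id PGL_one PGL_mul.
Proof. by move=> x; rewrite -(toPGL_repr x) -toPGL_mul mul1g. Qed.
Fact PGL_mulr1 : right_id PGL_one PGL_mul.
Proof. by move=> x; rewrite -(toPGL_repr x) -toPGL_mul mulg1. Qed.
Fact PGL_mulV : left_inverse PGL_one PGL_inv PGL_mul.
Proof.
by move=> x; rewrite -(toPGL_repr x) -toPGL_inv -toPGL_mul mulVg.
Qed.
Fact PGL_mulrV : right_inverse PGL_one PGL_inv PGL_mul.
Proof.
by move=> x; rewrite -(toPGL_repr x) -toPGL_inv -toPGL_mul mulgV.
Qed.
HB.instance Definition _ :=
  isGroup.Build PGL PGL_mulA PGL_mul1 PGL_mulr1 PGL_mulV PGL_mulrV.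

(* Every notion below that is defined through this representative is invariant
   under scaling of the representative. *)
Definition rep (m : PGL) : 'M[F]_k := repr m.

End GL.

Section RealPGL.
Variables (R : realType) (k : nat).
Local Notation C := R[i].

Definition complexify (N : GL R k) : GL C k :=
  @MkGL C k (map_mx (real_complex R) N)
    (etrans (map_unitmx (real_complex R) N) (GLmx_unit N)).

Definition real_PGL : set (PGL C k) := range (fun N => toPGL (complexify N)).

Definition simultaneously_conjugate_into_real (I : Type) (M : I -> PGL C k) :=
  exists G : PGL C k, forall j, real_PGL (G^-1 * M j * G)%g.

End RealPGL.

Section Eigen.
Variables (R : realType) (k : nat).
Local Notation C := R[i].
Implicit Types (m : PGL C k) (u a b z : C) (U V : {vspace 'cV[C]_k}).

(* The real lines through 0 in C are the sets R u with u != 0; such a line is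
   given by the direction vector u. *)
Definition on_line u z : Prop := exists t : R, z = t%:C * u.

(* The reflection about the line R u: it is conjugate-R-linear and fixes u. *)
Definition reflection u z : C := u * conjc (z / u).

Definition swapped u a b : Prop := reflection u a = b /\ reflection u b = a.

(* [eigenvalue] uses row vectors; left and right eigenvalues coincide. *)
Definition eigenval m a : Prop := eigenvalue (rep m) a.

(* A point of CP^(k-1) is a line <[v]> in C^k, with v != 0. *)
Definition eigendirection m a U : Prop :=
  exists v : 'cV[C]_k, [/\ v != 0, rep m *m v = a *: v & U = <[v]>%VS].

Definition compatible_line m u : Prop :=
  u != 0 /\
  forall a, eigenval m a ->
    on_line u a \/ exists b, [/\ eigenval m b, b != a & swapped u a b].

Definition compatible_eigenvalues m : Prop := exists u, compatible_line m u.

Definition no_repeated_eigenvalues m : Prop :=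
  forall a, (mup a (char_poly (rep m)) <= 1)%N.

(* The line containing both eigenvalues and the axis of the reflection swapping
   them are quantified separately: if they were the same line, then the
   reflection would fix both eigenvalues. *)
Definition generic_eigenvalues m : Prop :=
  no_repeated_eigenvalues m /\
  forall a b, eigenval m a -> eigenval m b -> a != b ->
    ~ ((exists u, [/\ u != 0, on_line u a & on_line u b]) /\
       (exists u, u != 0 /\ swapped u a b)).

Definition hyperbolic_wrt u m U : Prop :=
  exists a, [/\ eigenval m a, on_line u a & eigendirection m a U].

Definition elliptic_pair_wrt u m U V : Prop :=
  exists a b, [/\ a != b, swapped u a b,
    eigendirection m a U & eigendirection m b V].

Definition elliptic_wrt u m U : Prop := exists V, elliptic_pair_wrt u m U V.

(* This does not follow from genericity: the eigenvalues 1, w, w^2, with w a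
   primitive cube root of unity, are generic but admit three compatible lines with
   different labellings. *)
Definition line_independent_labels m : Prop :=
  forall u u', compatible_line m u -> compatible_line m u' ->
    [/\ forall U, hyperbolic_wrt u m U <-> hyperbolic_wrt u' m U,
        forall U, elliptic_wrt u m U <-> elliptic_wrt u' m U &
        forall U V, elliptic_pair_wrt u m U V <-> elliptic_pair_wrt u' m U V].

(* Under [line_independent_labels], the labels below are those given by any
   compatible line. *)
Definition hyperbolic_eigendirection m U : Prop :=
  exists u, compatible_line m u /\ hyperbolic_wrt u m U.

Definition elliptic_eigendirection_pair m U V : Prop :=
  exists u, compatible_line m u /\ elliptic_pair_wrt u m U V.

End Eigen.

Section RForm.
Variables (R : realType) (k : nat).
Local Notation C := R[i].
Implicit Types (S : set 'cV[C]_k) (B : 'M[C]_k) (s : 'cV[C]_k -> 'cV[C]_k).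

(* C-bases of C^k are encoded as the columns of an invertible matrix B. *)
Definition real_span B : set 'cV[C]_k :=
  range (fun x : 'cV[R]_k => B *m map_mx (real_complex R) x).

Definition real_basis S B : Prop := B \in unitmx /\ S = real_span B.

Definition is_real_form S : Prop := exists B, real_basis S B.

Definition conj_in_basis B (v : 'cV[C]_k) : 'cV[C]_k :=
  B *m map_mx (@conjc R) (invmx B *m v).

(* The value does not depend on the basis chosen; see [form_conjE]. *)
Definition form_conj S : 'cV[C]_k -> 'cV[C]_k :=
  conj_in_basis (xget 1%:M [set B | real_basis S B]).

Lemma map_conj_real m n (X : 'M[R]_(m, n)) :
  map_mx (@conjc R) (map_mx (real_complex R) X) = map_mx (real_complex R) X.
Proof. by apply/matrixP=> i j; rewrite !mxE conjc_real. Qed.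

Lemma form_conjE S B : real_basis S B -> form_conj S = conj_in_basis B.
Proof.
move=> hB; rewrite /form_conj; case: xgetP => [D _ [uD eD]|/(_ B)//].
case: hB => uB eB; apply/funext => v; rewrite /conj_in_basis.
have [P eP] : exists P : 'M[R]_k, D = B *m map_mx (real_complex R) P.
  have /choice[f fP] (j : 'I_k) : exists x : 'cV[R]_k,
      col j D = B *m map_mx (real_complex R) x.
    have : real_span D (col j D).
      exists (delta_mx j 0) => //; rewrite colE; congr (_ *m _).
      by apply/matrixP=> i l; rewrite !mxE; case: (_ && _).
    by rewrite -eD eB => -[x _ <-]; exists x.
  exists (\matrix_(i, j) f j i 0); apply/matrixP => i j.
  have /matrixP/(_ i 0) := fP j; rewrite !mxE => ->.
  by apply: eq_bigr => l _; rewrite !mxE.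
have -> : invmx B *m v = map_mx (real_complex R) P *m (invmx D *m v).
  rewrite -[v in LHS](mulKVmx uD); set w := invmx D *m v.
  by rewrite -[RHS](mulKmx uB) (mulmxA B) -eP.
by rewrite [in RHS]map_mxM map_conj_real mulmxA -eP.
Qed.

Lemma form_conj_additive S v w :
  is_real_form S -> form_conj S (v + w) = form_conj S v + form_conj S w.
Proof.
by move=> [B hB]; rewrite (form_conjE hB) /conj_in_basis mulmxDr map_mxD mulmxDr.
Qed.

Lemma form_conjZ S a v :
  is_real_form S -> form_conj S (a *: v) = conjc a *: form_conj S v.
Proof.
move=> [B hB]; rewrite (form_conjE hB) /conj_in_basis -scalemxAr.
by rewrite (map_mxZ (@conjc R)) -scalemxAr.
Qed.

Lemma form_conjK S : is_real_form S -> involutive (form_conj S).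
Proof.
move=> [B hB] v; rewrite (form_conjE hB) /conj_in_basis; case: hB => uB _.
rewrite mulKmx // -[map_mx _ (map_mx _ _)]map_mx_comp.
rewrite (_ : map_mx _ _ = invmx B *m v) ?mulKVmx //.
by apply/matrixP => i j; rewrite mxE /= conjcK.
Qed.

(* The map on CP^(k-1) induced by a conjugate-linear map s: the image of a
   subspace under such an s is the span of the images of any basis. *)
Definition induced s (U : {vspace 'cV[C]_k}) : {vspace 'cV[C]_k} :=
  <<map s (vbasis U)>>%VS.

Lemma induced_line s (v : 'cV[C]_k) :
  (forall a w, s (a *: w) = conjc a *: s w) -> v != 0 ->
  induced s <[v]> = <[s v]>%VS.
Proof.
move=> hs v0; have d1 : \dim <[v]> = 1%N by rewrite dim_vline v0.
rewrite /induced; have := vbasisP <[v]>.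
case: (vbasis _) => b; rewrite /= d1; case: b => [|w []] //= _ hb.
have := span_basis hb; rewrite span_seq1 => ew.
have /vlineP[c ec] : w \in <[v]>%VS by rewrite -ew memv_line.
have c0 : c != 0.
  by apply: contraTneq (basis_free hb) => c0; rewrite ec c0 scale0r seq1_free eqxx.
rewrite span_seq1 ec hs; apply/eqP; rewrite eqEsubv -!memvE memvZ ?memv_line //=.
have cc0 : conjc c != 0 by rewrite conjc_eq0.
by rewrite -[X in X \in _](scale1r (s v)) -(mulVf cc0) -scalerA memvZ ?memv_line.
Qed.

Definition respects (m : PGL C k) s : Prop :=
  (forall U, hyperbolic_eigendirection m U -> induced s U = U) /\
  (forall U V, elliptic_eigendirection_pair m U V ->
     induced s U = V /\ induced s V = U).

End RForm.

(* Main.v *)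
(* Let s be a conjugation of C^k and A a representative of m.  If
   A = c P N P^-1 with N real and s is the conjugation in the basis P, then s
   sends an eigenvector for a to one for the reflection of a about the line R c.
   Hence R c is a compatible line, and as the eigenspaces are lines, s respects
   the eigendirections as labelled by it; the labels do not depend on the line.
   Conversely, if s respects the eigendirections as labelled by a compatible line
   R u, then A/u commutes with s on every eigenvector; these span C^k, so A/u
   commutes with s and is real in any basis of the R-form. *)

Require Import Defs.
From mathcomp Require Import all_boot all_order all_algebra.
From mathcomp Require Import boolp classical_sets reals.
From mathcomp Require Import complex.

Set Implicit Arguments.
Unset Strict Implicit.
Unset Printing Implicit Defensive.

Import GRing.Theory Num.Theory.
Local Open Scope ring_scope.

Lemma col_mulmx (F : pzSemiRingType) m n p (A : 'M[F]_(m, n)) (B : 'M_(n, p)) j :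
  col j (A *m B) = A *m col j B.
Proof. by rewrite !colE mulmxA. Qed.

(** The relation gives [(X - A) Q = Q (X - D)] over the polynomials; taking determinants, the
    nonzero constant [\det Q] cancels. *)
Lemma char_poly_intertwine (F : fieldType) n (A D Q : 'M[F]_n) :
  Q \in unitmx -> A *m Q = Q *m D -> char_poly A = char_poly D.
Proof.
move=> uQ eAQ; have nzQ : \det (map_mx polyC Q) != 0.
  by rewrite det_map_mx polyC_eq0 -unitfE -unitmxE.
apply: (mulIf nzQ); rewrite /char_poly [RHS]mulrC -!det_mulmx; congr (\det _).
rewrite /char_poly_mx mulmxBl mulmxBr -!map_mxM /= eAQ.
by rewrite mul_scalar_mx mul_mx_scalar.
Qed.

(** A matrix and its transpose have the same characteristic polynomial, so row eigenvectors may be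
    traded for column ones. *)
Lemma eigenvalue_colP (F : fieldType) n (A : 'M[F]_n) a :
  eigenvalue A a <-> exists2 v : 'cV[F]_n, A *m v = a *: v & v != 0.
Proof.
have -> : eigenvalue A a = eigenvalue A^T a.
  rewrite !eigenvalue_root_char /char_poly -[in LHS]det_tr.
  by rewrite /char_poly_mx linearB /= tr_scalar_mx map_trmx.
split=> [/eigenvalueP[v eAv nzv]|[v eAv nzv]]; last apply/eigenvalueP; exists v^T.
- by rewrite -[LHS]trmxK trmx_mul trmxK eAv linearZ.
- by rewrite trmx_eq0.
- by rewrite -trmx_mul eAv linearZ.
- by rewrite trmx_eq0.
Qed.

(** The characteristic polynomial splits into distinct linear factors, and the minimal polynomial
    divides it, so [A] is diagonalizable. *)
Lemma simple_spectrum_diag (F : closedFieldType) n (A : 'M[F]_n) :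
  (forall a, (mup a (char_poly A) <= 1)%N) ->
  exists Q d, [/\ Q \in unitmx, A *m Q = Q *m diag_mx d & injective (d 0)].
Proof.
case: n A => [|n] A simA.
  by exists 1%:M, 0; split=> [||[]//]; rewrite ?unitmx1 //; apply/matrixP => -[].
have [|P uP simP] := (diagonalizableP A).2.
  have [rs] := closed_field_poly_normal (char_poly A).
  rewrite (monicP (char_poly_monic A)) scale1r => ers.
  exists rs; last by rewrite -ers mxminpoly_dvd_char.
  by apply/count_mem_uniq => x; have := simA x; rewrite ers mu_prod_XsubC;
    case: (boolP (x \in rs)) => [|/count_memPn -> //];
    rewrite -has_pred1 has_count; case: count => [|[]].
have /diagonalizable_forPex[d /(simmxP uP) ePA] := simP.
have eAQ : A *m invmx P = invmx P *m diag_mx d.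
  by rewrite -[LHS](mulKmx uP) (mulmxA P) ePA -mulmxA mulmxV // mulmx1.
have uQ : invmx P \in unitmx by rewrite unitmx_inv.
exists (invmx P), d; split=> // i j eij; apply/eqP; apply: contraT => nij.
(* Equal entries at [i] and [j] would make the square of ['X - (d 0 i)%:P] divide the characteristic
   polynomial. *)
have := simA (d 0 i); rewrite (char_poly_intertwine uQ eAQ).
rewrite char_poly_trig ?diag_mx_is_trig // (bigD1 i) //= (bigD1 j) 1?eq_sym //=.
rewrite !mxE !eqxx !mulr1n eij mulrA -expr2.
by rewrite leqNgt mup_geq ?dvdp_mulIl // mulf_neq0 ?expf_neq0 ?polyXsubC_eq0 //;
  apply/prodf_neq0 => l _; rewrite polyXsubC_eq0.
Qed.

(** In the eigenbasis [Q], an eigenvector for [a] has nonzero coordinates only where the diagonal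
    entry is [a], that is, at a single index. *)
Lemma simple_eigenspace (F : closedFieldType) n (A : 'M[F]_n) a (v w : 'cV_n) :
  (forall b, (mup b (char_poly A) <= 1)%N) -> v != 0 ->
  A *m v = a *: v -> A *m w = a *: w -> exists c, w = c *: v.
Proof.
move=> /simple_spectrum_diag[Q [d [uQ eAQ injd]]] nzv eAv eAw.
have coord (x : 'cV_n) i : A *m x = a *: x -> (invmx Q *m x) i 0 != 0 -> d 0 i = a.
  move=> eAx nzx; apply: (mulIf nzx).
  have /matrixP/(_ i 0) : diag_mx d *m (invmx Q *m x) = a *: (invmx Q *m x).
    by rewrite scalemxAr -eAx -{2}(mulKVmx uQ x) (mulmxA A) eAQ -mulmxA mulKmx.
  by rewrite mul_diag_mx !mxE.
have /existsP[i nzi] : [exists i, (invmx Q *m v) i 0 != 0].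
  apply: contraNT nzv; rewrite negb_exists => /forallP z.
  rewrite -(mulKVmx uQ v) (_ : invmx Q *m v = 0) ?mulmx0 //.
  by apply/matrixP => i j; rewrite (ord1 j) [RHS]mxE; apply/eqP/negbNE/z.
(* The scalar is the ratio of the coordinates at that index; all other coordinates of [v] and [w]
   vanish. *)
exists ((invmx Q *m w) i 0 / (invmx Q *m v) i 0).
apply: (can_inj (mulKmx (_ : invmx Q \in unitmx))); first by rewrite unitmx_inv.
apply/matrixP => l j; rewrite (ord1 j) -scalemxAr [RHS]mxE.
have [-> |nli] := eqVneq l i; first by rewrite divfK.
have z (x : 'cV_n) : A *m x = a *: x -> (invmx Q *m x) l 0 = 0.
  move=> eAx; apply: contraNeq nli => /(coord _ _ eAx) el.
  by apply/eqP/injd; rewrite el (coord v).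
by rewrite !z // mulr0.
Qed.

(** This turns equalities between points of projective space back into matrix equations. *)
Lemma eigenvector_line (F : fieldType) n (A : 'M[F]_n) a (v w : 'cV_n) :
  (<[w]> = <[v]>)%VS -> A *m v = a *: v -> A *m w = a *: w.
Proof.
move=> evw eAv; have /vlineP[c ->] : w \in <[v]>%VS by rewrite -evw memv_line.
by rewrite -scalemxAr eAv !scalerA mulrC.
Qed.

Lemma eigen_line_eq (F : closedFieldType) n (A : 'M[F]_n) a (v w : 'cV_n) :
  (forall b, (mup b (char_poly A) <= 1)%N) -> v != 0 -> w != 0 ->
  A *m v = a *: v -> A *m w = a *: w -> (<[v]> = <[w]>)%VS.
Proof.
move=> simA nzv nzw eAv eAw.
have [c ec] := simple_eigenspace simA nzw eAw eAv.
have c0 : c != 0 by apply: contraNneq nzv => c0; rewrite ec c0 scale0r.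
apply/eqP; rewrite eqEsubv -!memvE ec memvZ ?memv_line //=.
by rewrite -[X in X \in _](scale1r w) -(mulVf c0) -scalerA memvZ ?memv_line.
Qed.

Section Reality.
Variables (R : realType) (k : nat).
Local Notation C := R[i].
Implicit Types (A B : 'M[C]_k) (m : PGL C k).

Lemma real_mx_conj p q (X : 'M[C]_(p, q)) :
  map_mx (@conjc R) X = X -> exists N, X = map_mx (real_complex R) N.
Proof.
move=> eX; exists (map_mx (@complex.Re R) X); apply/matrixP => i j.
have /matrixP/(_ i j) := eX; rewrite !mxE; case: (X i j) => x y [] /eqP.
by rewrite eq_sym -addr_eq0 -mulr2n mulrn_eq0 /= => /eqP ->.
Qed.

Lemma conj_in_basisZ B a v :
  conj_in_basis B (a *: v) = conjc a *: conj_in_basis B v.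
Proof.
by rewrite /conj_in_basis -scalemxAr (map_mxZ (@conjc R)) -scalemxAr.
Qed.

Lemma conj_in_basis_neq0 B v :
  B \in unitmx -> v != 0 -> conj_in_basis B v != 0.
Proof.
move=> uB; apply: contraNneq => e.
suff e0 : invmx B *m v = 0 by rewrite -(mulKVmx uB v) e0 mulmx0.
apply/matrixP => i j; rewrite [RHS]mxE; apply/eqP; rewrite -conjc_eq0.
have /matrixP/(_ i j) : map_mx (@conjc R) (invmx B *m v) = 0.
  by rewrite -(mulKmx uB (map_mx _ _)) [_ *m map_mx _ _]e mulmx0.
by rewrite [RHS]mxE mxE => ->.
Qed.

(** As [N] is real, the conjugation commutes with [A / c] and so conjugates its eigenvalue [a / c];
    multiplying back by [c] gives the reflection of [a]. *)
Lemma conj_eigenvector A B c (N : 'M[R]_k) a v :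
  B \in unitmx -> c != 0 ->
  A = c *: (B *m map_mx (real_complex R) N *m invmx B) ->
  A *m v = a *: v ->
  A *m conj_in_basis B v = reflection c a *: conj_in_basis B v.
Proof.
move=> uB c0 eA eAv; rewrite /reflection -scalerA -conj_in_basisZ.
have -> : (a / c) *: v = B *m map_mx (real_complex R) N *m invmx B *m v.
  by rewrite mulrC -scalerA -eAv eA -scalemxAl scalerA mulVf // scale1r.
rewrite eA -scalemxAl; congr (_ *: _); rewrite /conj_in_basis -!mulmxA !mulKmx //.
by rewrite [in RHS]map_mxM map_conj_real.
Qed.

Lemma reflection_on_line (u a : C) : u != 0 -> on_line u a <-> reflection u a = a.
Proof.
move=> u0; rewrite /reflection; split=> [[t ->]|e].
  by rewrite mulfK // conjc_real mulrC.
exists (complex.Re (a / u)); apply: (mulIf (_ : u^-1 != 0)); first by rewrite invr_eq0.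
rewrite mulfK // -{1}e mulrAC divff // mul1r.
have : conjc (a / u) = a / u by rewrite -{2}e mulrAC divff // mul1r.
case: (a / u) => x y /= [] /eqP; rewrite eq_sym -addr_eq0 -mulr2n mulrn_eq0 /=.
by move=> /eqP ->; rewrite oppr0.
Qed.

Lemma reflectionK (u : C) : u != 0 -> involutive (reflection u).
Proof. by move=> u0 a; rewrite /reflection mulrAC divff // mul1r conjcK mulrC divfK. Qed.

Lemma real_model_respects m B c (N : 'M[R]_k) :
  no_repeated_eigenvalues m -> line_independent_labels m ->
  B \in unitmx -> c != 0 ->
  rep m = c *: (B *m map_mx (real_complex R) N *m invmx B) ->
  respects m (conj_in_basis B).
Proof.
move=> simm labm uB c0 em.
have ceig a v := conj_eigenvector uB c0 em (a := a) (v := v).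
have comp : compatible_line m c.
  split=> // a /eigenvalue_colP[v eAv nzv].
  have [e|ne] := eqVneq (reflection c a) a; [left|right; exists (reflection c a)].
    exact/reflection_on_line.
  split=> //; last by split=> //; apply: reflectionK.
  apply/eigenvalue_colP; exists (conj_in_basis B v); first exact: ceig.
  exact: conj_in_basis_neq0.
have ind v : v != 0 -> induced (conj_in_basis B) <[v]> = <[conj_in_basis B v]>%VS.
  exact/induced_line/conj_in_basisZ.
(* The conjugate of [v] is an eigenvector for [b], and the eigenspace of [b] is a line, so it is the
   line of [w]. *)
have img a b v w : reflection c a = b -> v != 0 -> w != 0 ->
    rep m *m v = a *: v -> rep m *m w = b *: w ->
    induced (conj_in_basis B) <[v]> = <[w]>%VS.
  move=> eab nzv nzw eAv eAw; rewrite ind //.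
  apply: (eigen_line_eq simm (a := b)) => //; first exact: conj_in_basis_neq0.
  by rewrite -eab; apply: ceig.
(* The label of [U] may come from another compatible line [u]; line independence carries it over to
   the line of [c]. *)
split=> [U|U V] [u [cu hU]]; have [hyp _ ell] := labm _ _ cu comp.
  have [a [_ /reflection_on_line ea [v [nzv eAv ->]]]] := (hyp U).1 hU.
  exact: (img a a) (ea c0) _ _ _ _.
have [a [b [_ [eab eba] [v [nzv eAv ->]] [w [nzw eAw ->]]]]] := (ell U V).1 hU.
by split; [apply: (img a b)|apply: (img b a)].
Qed.

(** A converse to [conj_eigenvector]: respecting eigendirections only locates the line of the
    conjugate vector, but that already determines its eigenvalue. *)
Lemma respects_conj_eigenvector m B u a v :
  compatible_line m u -> respects m (conj_in_basis B) ->
  v != 0 -> rep m *m v = a *: v ->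
  rep m *m conj_in_basis B v = reflection u a *: conj_in_basis B v.
Proof.
move=> cu [hyp ell] nzv eAv; have [u0 lab] := cu.
have eiga : eigenval m a by apply/eigenvalue_colP; exists v.
have ind : induced (conj_in_basis B) <[v]> = <[conj_in_basis B v]>%VS.
  exact/induced_line/nzv/conj_in_basisZ.
have [la|[b [/eigenvalue_colP[w eAw nzw] nba [eab eba]]]] := lab _ eiga.
  rewrite ((reflection_on_line a u0).1 la).
  apply: (eigenvector_line _ eAv); rewrite -ind; apply: hyp.
  by exists u; split=> //; exists a; split=> //; exists v.
rewrite eab; apply: (eigenvector_line _ eAw); rewrite -ind.
have [|-> _ //] := ell <[v]>%VS <[w]>%VS.
by exists u; split=> //; exists a, b; rewrite eq_sym; split=> //; [exists v|exists w].
Qed.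

Lemma respects_real_model m B u :
  no_repeated_eigenvalues m -> compatible_line m u -> B \in unitmx ->
  respects m (conj_in_basis B) ->
  exists N : 'M[R]_k,
    invmx B *m rep m *m B = u *: map_mx (real_complex R) N.
Proof.
move=> simm cu uB resp; have [u0 _] := cu.
have [Q [d [uQ eAQ _]]] := simple_spectrum_diag simm.
(* [X] is [rep m / u] written in the basis [B], and the columns of [Y] are the eigenvectors in the
   same coordinates. *)
pose X := u^-1 *: (invmx B *m rep m *m B); pose Y := invmx B *m Q.
pose D := diag_mx (u^-1 *: d).
have eXY : X *m Y = Y *m D.
  rewrite /X /Y /D -scalemxAl linearZ -scalemxAr; congr (_ *: _).
  by rewrite -!mulmxA mulKVmx // eAQ.
have eXcY : X *m map_mx (@conjc R) Y = map_mx (@conjc R) Y *m map_mx (@conjc R) D.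
  (* Compared column by column: column [i] of the conjugate of [Y] represents the conjugate of the
     eigenvector [col i Q]. *)
  apply/matrixP => x i.
  have nzv : col i Q != 0.
    apply: contraTneq uQ => Q0; rewrite -unitmx_tr -row_free_unit.
    apply/negP => /row_freeP[Z] /(congr1 (row i)).
    rewrite row_mul -tr_col Q0 trmx0 mul0mx => /matrixP/(_ 0 i)/eqP.
    by rewrite !mxE eqxx eq_sym oner_eq0.
  have eAv : rep m *m col i Q = d 0 i *: col i Q.
    by rewrite -col_mulmx eAQ mul_mx_diag; apply/matrixP => y z; rewrite !mxE mulrC.
  have eXi : X *m col i (map_mx (@conjc R) Y) =
      conjc (d 0 i / u) *: col i (map_mx (@conjc R) Y).
    rewrite /X -map_col col_mulmx -scalemxAl -!mulmxA.
    rewrite -[B *m _]/(conj_in_basis B (col i Q)).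
    rewrite (respects_conj_eigenvector cu resp nzv eAv) /reflection.
    by rewrite -scalemxAr mulKmx // scalerA mulrA mulVf // mul1r.
  transitivity (col i (X *m map_mx (@conjc R) Y) x 0); first by rewrite [RHS]mxE.
  rewrite col_mulmx eXi map_diag_mx mul_mx_diag !mxE mulrC.
  by rewrite (mulrC (d 0 i)).
have uY : map_mx (@conjc R) Y \in unitmx.
  by rewrite map_unitmx unitmx_mul unitmx_inv uB.
have [|N eN] := @real_mx_conj _ _ X.
  (* Conjugating [eXY] and comparing with [eXcY], the invertible conjugate of [Y] cancels, so [X]
     equals its conjugate. *)
  apply: (can_inj (mulmxK uY)).
  by rewrite -map_mxM /= eXY map_mxM eXcY.
by exists N; rewrite -eN scalerA divff // scale1r.
Qed.

End Reality.

Theorem theorem1 (R : realType) (k : nat) (hk : (2 <= k)%N)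
    (I : Type) (M : I -> PGL (complex R) k)
    (hcompat : forall j, compatible_eigenvalues (M j))
    (hgeneric : forall j, generic_eigenvalues (M j))
    (hlabels : forall j, line_independent_labels (M j)) :
  simultaneously_conjugate_into_real M <->
  exists S : set 'cV[complex R]_k,
    is_real_form S /\ forall j, respects (M j) (form_conj S).
Proof.
split=> [[G realM]|[S [[B hB] resp]]].
  (* The R-form is spanned over the reals by the columns of a representative of the conjugating
     element [G]. *)
  have hB : real_basis (real_span (rep G)) (rep G) by split=> //; apply: GLmx_unit.
  exists (real_span (rep G)); split=> [|j]; first by exists (rep G).
  rewrite (form_conjE hB); have [N _ eN] := realM j.
  have eM : M j = toPGL (repr G * complexify N * (repr G)^-1)%g.
    rewrite !toPGL_mul toPGL_inv toPGL_repr eN.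
    by rewrite -[RHS]/(G * (G^-1 * M j * G) * G^-1)%g !mulgA mulgV mul1g mulgK.
  (* The chosen representative of [M j] matches this product only up to a scalar [c], whose line is
     the compatible one. *)
  have [c c0 ec] := repr_toPGL (repr G * complexify N * (repr G)^-1)%g.
  apply: (real_model_respects (hgeneric j).1 (hlabels j) (GLmx_unit _) c0 (N := N)).
  by rewrite eM; exact: ec.
have uB := hB.1; exists (toPGL (MkGL uB)) => j; have [u cu] := hcompat j.
have [] := respects_real_model (hgeneric j).1 cu uB (u := u) (B := B).
  by rewrite -(form_conjE hB).
(* By [eN], [u] times [N] is a product of invertible matrices, so [N] itself defines an element of
   [GL]. *)
move=> N eN; have uN : N \in unitmx.
  rewrite -(map_unitmx (real_complex R)) -(unitmxZ _ (_ : u \is a GRing.unit)).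
    by rewrite -eN !unitmx_mul unitmx_inv uB GLmx_unit.
  by rewrite unitfE cu.1.
exists (MkGL uN) => //.
transitivity (toPGL ((MkGL uB)^-1 * repr (M j) * MkGL uB)%g); last first.
  by rewrite !toPGL_mul toPGL_inv toPGL_repr.
(* The factor [u] in [eN] disappears in the projective group. *)
apply/toPGLP; exists u^-1; first by rewrite invr_eq0 cu.1.
by rewrite [GLmx _ in RHS]eN scalerA mulVf ?scale1r // cu.1.
Qed.
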